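(* Let $K$ be any Henselian valued field. There does not exist an existential formula $\psi(x)$ in $\mathcal{L}_{\rm ring}$ such that $\mathcal{O}_L=\psi(L)$ for all finite extensions $L$ of $K$. Neither does there exist a universal formula $\eta(x)$ in $\mathcal{L}_{\rm ring}$ such that $\mathcal{O}_L=\eta(L)$ for all finite extensions $L$ of $K$.
   Context: $\mathcal{L}_{\rm ring}=(+,-,\cdot,0,1)$ is the language of rings; formulas are without parameters. A Henselian valued field $K$ has a nontrivial Henselian valuation; each finite extension $L$ of $K$ carries the unique valuation extending that of $K$, with valuation ring $\mathcal{O}_L$. An existential (resp. universal) formula is one of the form $\exists \bar y\,\psi$ (resp. $\forall \bar y\,\psi$) with $\psi$ quantifier-free. $\psi(L)$ denotes the set of elements of $L$ satisfying $\psi$. *)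

(* Defs.v *)
From HB Require Import structures.
From mathcomp Require Import all_boot all_order all_algebra all_field.

Set Implicit Arguments.
Unset Strict Implicit.
Unset Printing Implicit Defensive.

Import Order.TTheory GRing.Theory Num.Theory.
Local Open Scope ring_scope.

(* Krull valuations of arbitrary rank, written additively. [porderZmodType]
   does not relate the order to the addition, so totality and translation
   invariance are required here. The value at 0 stands for +oo; [vval] is
   unconstrained there and every use of [vval] is guarded accordingly. *)
Record valuation (K : fieldType) := Valuation {
  vgroup : porderZmodType;
  vgroup_total : total (<=%R : rel vgroup);
  vgroup_leD : forall c a b : vgroup, a <= b -> c + a <= c + b;
  vval : K -> vgroup;
  vval_surj : forall g : vgroup, exists2 x : K, x != 0 & vval x = g;
  vvalM : forall x y : K, x != 0 -> y != 0 -> vval (x * y) = vval x + vval y;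
  vvalD : forall x y : K, x != 0 -> y != 0 -> x + y != 0 ->
    (vval x <= vval (x + y)) || (vval y <= vval (x + y))
}.

Definition valring (K : fieldType) (v : valuation K) : pred K :=
  fun x => (x == 0) || (0 <= vval v x).

Definition valideal (K : fieldType) (v : valuation K) : pred K :=
  fun x => (x == 0) || (0 < vval v x).

Definition nontrivial_valuation (K : fieldType) (v : valuation K) : Prop :=
  exists2 x : K, x != 0 & vval v x != 0.

Definition henselian (K : fieldType) (v : valuation K) : Prop :=
  forall (p : {poly K}) (a : K),
    (forall i : nat, p`_i \in valring v) -> a \in valring v ->
    p.[a] \in valideal v -> p^`().[a] \notin valideal v ->
    exists b : K, [/\ b \in valring v, root p b & b - a \in valideal v].

(* The embedding of value groups is part of the notion of extension, since the
   value groups of v and w are distinct types. *)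
Definition valuation_extends (K : fieldType) (L : fieldExtType K)
    (v : valuation K) (w : valuation L) : Prop :=
  exists f : {additive vgroup v -> vgroup w},
    {mono f : a b / a <= b} /\
    (forall x : K, x != 0 -> vval w (x%:A) = f (vval v x)).

(* Parameter-free first-order syntax of (+, -, *, 0, 1); the index n is the
   number of free variables, and a quantifier binds the variable 0 of its
   body, shifting the others. *)
Inductive rterm (n : nat) : Type :=
| RVar of 'I_n
| RZero
| ROne
| RAdd of rterm n & rterm n
| ROpp of rterm n
| RMul of rterm n & rterm n.

Inductive rformula : nat -> Type :=
| RFalse n : rformula n
| REq n : rterm n -> rterm n -> rformula n
| RNot n : rformula n -> rformula n
| RAnd n : rformula n -> rformula n -> rformula n
| ROr n : rformula n -> rformula n -> rformula n
| RImp n : rformula n -> rformula n -> rformula n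
| RExists n : rformula n.+1 -> rformula n
| RForall n : rformula n.+1 -> rformula n.

Fixpoint quantifier_free n (phi : rformula n) : bool :=
  match phi with
  | RFalse _ | REq _ _ _ => true
  | RNot _ f => quantifier_free f
  | RAnd _ f g | ROr _ f g | RImp _ f g =>
      quantifier_free f && quantifier_free g
  | RExists _ _ | RForall _ _ => false
  end.

Fixpoint existential n (phi : rformula n) : bool :=
  if phi is RExists _ f then existential f else quantifier_free phi.

Fixpoint universal n (phi : rformula n) : bool :=
  if phi is RForall _ f then universal f else quantifier_free phi.

Section Semantics.
Variable R : nzRingType.

Fixpoint reval n (e : 'I_n -> R) (t : rterm n) : R :=
  match t with
  | RVar i => e i
  | RZero => 0
  | ROne => 1
  | RAdd t u => reval e t + reval e u
  | ROpp t => - reval e t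
  | RMul t u => reval e t * reval e u
  end.

Definition env_cons n (y : R) (e : 'I_n -> R) : 'I_n.+1 -> R :=
  fun i => oapp e y (unlift ord0 i).

Fixpoint satisfies n (phi : rformula n) : ('I_n -> R) -> Prop :=
  match phi in rformula n return ('I_n -> R) -> Prop with
  | RFalse _ => fun _ => False
  | REq _ t u => fun e => reval e t = reval e u
  | RNot _ f => fun e => ~ satisfies f e
  | RAnd _ f g => fun e => satisfies f e /\ satisfies g e
  | ROr _ f g => fun e => satisfies f e \/ satisfies g e
  | RImp _ f g => fun e => satisfies f e -> satisfies g e
  | RExists _ f => fun e => exists y : R, satisfies f (env_cons y e)
  | RForall _ f => fun e => forall y : R, satisfies f (env_cons y e)
  end.

Definition defined_set (phi : rformula 1) (x : R) : Prop :=
  satisfies phi (fun _ => x).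

End Semantics.

(* Main.v *)
(** Finite extensions of [K] approximate its algebraic closure, where a
    definable set is finite or cofinite by quantifier elimination,
    whereas the valuation ring and its complement both contain infinitely many
    powers of any [t] with [v t > 0].  To stay within countable fields, let
    [K0] be a countable subfield of [K] that contains [t] and, for every [x] in
    [K0] satisfying the existential formula [psi] in [K], witnesses of this
    fact; let [M] be the algebraic closure of [K0].  If [psi(x)] holds in [K]
    with [x] in [K0], then it holds in [K0], hence in [M].  If it holds in [M],
    the witnesses are algebraic over [K0] and the field they generate over [K0]
    maps to some finite extension [L] of [K], so [psi(x)] holds in [L] and [x]
    is a [v]-integer.  Thus [psi(M)] and the valuation ring have the same trace
    on [K0], which is impossible.  A universal formula is treated through its
    negation, which defines the complement of the valuation ring. *)
Require Import Defs.
From HB Require Import structures.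
From mathcomp Require Import all_boot all_order all_algebra all_field.
From mathcomp Require Import boolp.

Set Implicit Arguments.
Unset Strict Implicit.
Unset Printing Implicit Defensive.

Import Order.TTheory GRing.Theory Num.Theory.
Local Open Scope ring_scope.

(** * Transfer of formulas along ring morphisms *)

Lemma env_cons_comp (R S : nzRingType) (f : R -> S) n (y : R) (e : 'I_n -> R) :
  f \o env_cons y e = env_cons (f y) (f \o e).
Proof. by apply/funext => i; rewrite /env_cons /=; case: unlift. Qed.

Lemma existential_elim (P : forall n, rformula n -> Prop) :
  (forall n (phi : rformula n), quantifier_free phi -> P n phi) ->
  (forall n (phi : rformula n.+1),
     existential phi -> P n.+1 phi -> P n (RExists phi)) ->
  forall n (phi : rformula n), existential phi -> P n phi.
Proof.
move=> Pqf Pex n phi; elim: phi => {n} //; try by move=> *; apply: Pqf.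
by move=> n phi IHphi /= ex_phi; apply/Pex/IHphi.
Qed.

Lemma reval_rmorph (R S : nzRingType) (f : {rmorphism R -> S}) n
    (e : 'I_n -> R) (t : rterm n) : f (reval e t) = reval (f \o e) t.
Proof.
elim: t => //=; first exact: rmorph0.
- exact: rmorph1.
- by move=> t IHt u IHu; rewrite rmorphD IHt IHu.
- by move=> t IHt; rewrite rmorphN IHt.
- by move=> t IHt u IHu; rewrite rmorphM IHt IHu.
Qed.

(** A morphism out of a field is injective, so it reflects equations as well as preserving them;
    this carries negations. *)
Lemma qf_satisfies_rmorph (F : fieldType) (S : nzRingType)
    (f : {rmorphism F -> S}) n (phi : rformula n) (e : 'I_n -> F) :
  quantifier_free phi -> satisfies phi e <-> satisfies phi (f \o e).
Proof.
elim: phi e => {n} //= n.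
- move=> t u e _; rewrite -!reval_rmorph; split=> [-> //|]; exact: fmorph_inj.
- by move=> phi IH e qf; have := IH e qf; tauto.
- by move=> p IHp q IHq e /andP[qp qq]; have := (IHp e qp, IHq e qq); tauto.
- by move=> p IHp q IHq e /andP[qp qq]; have := (IHp e qp, IHq e qq); tauto.
- by move=> p IHp q IHq e /andP[qp qq]; have := (IHp e qp, IHq e qq); tauto.
Qed.

Lemma existential_satisfies_rmorph (F : fieldType) (S : nzRingType)
    (f : {rmorphism F -> S}) n (phi : rformula n) (e : 'I_n -> F) :
  existential phi -> satisfies phi e -> satisfies phi (f \o e).
Proof.
move=> ex_phi; elim/existential_elim: phi / ex_phi e => {}n phi.
  by move=> qf e; apply: (qf_satisfies_rmorph f e qf).1.
move=> _ IH e [y /IH]; rewrite env_cons_comp; by exists (f y).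
Qed.

(** [W] lists the values taken by the quantified variables. It is fixed before [F], so that a
    subfield can later be built to contain it. *)
Lemma existential_witnesses (K : fieldType) n (phi : rformula n)
    (e : 'I_n -> K) : existential phi -> satisfies phi e ->
  exists W : seq K, forall (F : fieldType) (j : {rmorphism F -> K})
      (e0 : 'I_n -> F),
    j \o e0 = e -> {in W, forall z, exists a, j a = z} -> satisfies phi e0.
Proof.
move=> ex_phi; elim/existential_elim: phi / ex_phi e => {}n phi.
  move=> qf e sat_e; exists [::] => F j e0 je0 _.
  by apply/(qf_satisfies_rmorph j e0 qf); rewrite je0.
move=> _ IH e [y /IH[W W_ok]]; exists (y :: W) => F j e0 je0 jW.
have [y0 jy0] := jW y (mem_head _ _).
exists y0; apply: (W_ok F j); first by rewrite env_cons_comp jy0 je0.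
by move=> z Wz; apply: jW; rewrite inE Wz orbT.
Qed.

(** Negation passes only through the leading universal quantifiers, which turns a universal formula
    into an existential one. *)
Fixpoint universal_dual n (phi : rformula n) : rformula n :=
  match phi in rformula n return rformula n with
  | RForall _ f => RExists (universal_dual f)
  | f => RNot f
  end.

Lemma universal_dualP n (phi : rformula n) : universal phi ->
  existential (universal_dual phi) /\
  forall (R : nzRingType) (e : 'I_n -> R),
    satisfies (universal_dual phi) e <-> ~ satisfies phi e.
Proof.
elim: phi => {n} //= n phi IH /IH[ex_phi sat_phi]; split=> // R e.
split=> [[y /sat_phi nphi] /(_ y) //|/existsNP[y nphi]].
by exists y; apply/sat_phi.
Qed.

(** * Definable subsets of an algebraically closed field *)

Section ClosedFieldDefinable.
Variable M : closedFieldType.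

(* A quantifier in context [n] binds the named variable ['X_n], hence the
   de Bruijn index [i] in context [n] is the name [n - i.+1]. *)
Fixpoint named_term n (t : rterm n) : GRing.term M :=
  match t with
  | RVar i => GRing.Var M (n - i.+1)
  | RZero => GRing.Const 0
  | ROne => GRing.Const 1
  | RAdd t u => GRing.Add (named_term t) (named_term u)
  | ROpp t => GRing.Opp (named_term t)
  | RMul t u => GRing.Mul (named_term t) (named_term u)
  end.

Fixpoint named_formula n (phi : rformula n) : GRing.formula M :=
  match phi with
  | RFalse _ => GRing.Bool false
  | REq _ t u => GRing.Equal (named_term t) (named_term u)
  | RNot _ f => GRing.Not (named_formula f)
  | RAnd _ f g => GRing.And (named_formula f) (named_formula g)
  | ROr _ f g => GRing.Or (named_formula f) (named_formula g)
  | RImp _ f g => GRing.Implies (named_formula f) (named_formula g)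
  | RExists n f => GRing.Exists n (named_formula f)
  | RForall n f => GRing.Forall n (named_formula f)
  end.

Definition named_env n (e : seq M) : 'I_n -> M := fun i => e`_(n - i.+1).
Arguments named_env n e : clear implicits.

(** The names used in context [n] are all below [n], so writing [x] at position [n] disturbs none of
    them. *)
Lemma named_env_cons n (e : seq M) (x : M) :
  named_env n.+1 (set_nth 0 e n x) = env_cons x (named_env n e).
Proof.
apply/funext => i; rewrite /named_env /env_cons nth_set_nth /=.
case: unliftP => [j ->|->] /=; last by rewrite subn1 eqxx.
by rewrite /bump /= subSS ltn_eqF // ltn_subrL (leq_ltn_trans _ (ltn_ord j)).
Qed.

Lemma eval_named_term n (t : rterm n) e :
  GRing.eval e (named_term t) = reval (named_env n e) t.
Proof. by elim: t => //= [t -> u ->|t ->|t -> u ->]. Qed.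

Lemma holds_named_formula n (phi : rformula n) e :
  GRing.holds e (named_formula phi) <-> satisfies phi (named_env n e).
Proof.
elim: phi e => {n} [n|n t u|n f IH|n f IHf g IHg|n f IHf g IHg|n f IHf g IHg
  |n f IH|n f IH] e /=.
- by [].
- by rewrite !eval_named_term.
- by rewrite IH.
- by rewrite IHf IHg.
- by rewrite IHf IHg.
- by rewrite IHf IHg.
- by split=> -[x]; move: (IH (set_nth 0 e n x)); rewrite named_env_cons
    => IHx /IHx; exists x.
- by split=> sat_f x; move: (IH (set_nth 0 e n x)); rewrite named_env_cons
    => IHx; apply/IHx/sat_f.
Qed.

Lemma rterm_named_term n (t : rterm n) : GRing.rterm (named_term t).
Proof. by elim: t => //= [t -> u ->|t -> u ->]. Qed.

Lemma rformula_named_formula n (phi : rformula n) :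
  GRing.rformula (named_formula phi).
Proof.
by elim: phi => //= *; rewrite ?rterm_named_term //; apply/andP.
Qed.

Lemma eval_rterm_poly (t : GRing.term M) : GRing.rterm t ->
  exists p : {poly M}, forall x, GRing.eval [:: x] t = p.[x].
Proof.
elim: t => //=.
- case=> [|n] _; first by exists 'X => x; rewrite hornerX.
  (* Any other variable lies beyond the environment [[:: x]] and takes the default value 0. *)
  by exists 0 => x; rewrite horner0 /= nth_nil.
- by move=> c _; exists c%:P => x; rewrite hornerC.
- by move=> n _; exists n%:R%:P => x; rewrite hornerC.
- move=> t IHt u IHu /andP[/IHt[p Dp] /IHu[q Dq]].
  by exists (p + q) => x; rewrite hornerD Dp Dq.
- by move=> t IHt /IHt[p Dp]; exists (- p) => x; rewrite hornerN Dp.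
- by move=> t IHt n /IHt[p Dp]; exists (p *+ n) => x; rewrite hornerMn Dp.
- move=> t IHt u IHu /andP[/IHt[p Dp] /IHu[q Dq]].
  by exists (p * q) => x; rewrite hornerM Dp Dq.
- by move=> t IHt n /IHt[p Dp]; exists (p ^+ n) => x; rewrite horner_exp Dp.
Qed.

(** An equation in one variable is a polynomial identity or holds only at the roots of a nonzero
    difference. Connectives multiply the exceptional polynomials and combine the generic truth
    values. *)
Lemma qf_eval_generic (f : GRing.formula M) :
  GRing.qf_form f -> GRing.rformula f ->
  exists2 p : {poly M}, p != 0 &
    exists b, forall x, p.[x] != 0 -> GRing.qf_eval [:: x] f = b.
Proof.
have bin (op : bool -> bool -> bool) g h :
    (exists2 p : {poly M}, p != 0 &
       exists b, forall x, p.[x] != 0 -> GRing.qf_eval [:: x] g = b) ->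
    (exists2 p : {poly M}, p != 0 &
       exists b, forall x, p.[x] != 0 -> GRing.qf_eval [:: x] h = b) ->
    exists2 p : {poly M}, p != 0 & exists b, forall x, p.[x] != 0 ->
      op (GRing.qf_eval [:: x] g) (GRing.qf_eval [:: x] h) = b.
  move=> [p nz_p [b Db]] [q nz_q [c Dc]]; exists (p * q); first by rewrite mulf_neq0.
  exists (op b c) => x; rewrite hornerM mulf_eq0 negb_or => /andP[px qx].
  by rewrite Db ?Dc.
elim: f => //=.
- by move=> b _ _; exists 1; [exact: oner_neq0 | exists b].
- move=> t u _ /andP[/eval_rterm_poly[p Dp] /eval_rterm_poly[q Dq]].
  have [eq_pq|neq_pq] := eqVneq p q.
    exists 1; first exact: oner_neq0.
    by exists true => x _; rewrite Dp Dq eq_pq eqxx.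
  exists (p - q); first by rewrite subr_eq0.
  exists false => x; rewrite hornerD hornerN subr_eq0 Dp Dq; exact: negPf.
- move=> f IHf g IHg /andP[? ?] /andP[? ?]; apply: (bin andb); auto.
- move=> f IHf g IHg /andP[? ?] /andP[? ?]; apply: (bin orb); auto.
- move=> f IHf g IHg /andP[? ?] /andP[? ?]; apply: (bin implb); auto.
- move=> f IHf qf rf; have [p nz_p [b Db]] := IHf qf rf.
  by exists p => //; exists (~~ b) => x /Db->.
Qed.

(** Quantifier elimination reduces to the quantifier-free case. This is an instance of strong
    minimality: [b] tells cofinite sets from finite ones. *)
Lemma defined_set_generic (phi : rformula 1) :
  exists2 p : {poly M}, p != 0 &
    exists b : bool, forall x, p.[x] != 0 -> defined_set phi x <-> b.
Proof.
have M_closed : GRing.closed_field_axiom M by exact: solve_monicpoly.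
pose f := GRing.quantifier_elim (@ClosedFieldQE.ex_elim M) (named_formula phi).
have /andP[qf rf] : GRing.qf_form f && GRing.rformula f.
  apply: GRing.quantifier_elim_wf (rformula_named_formula phi).
  exact: ClosedFieldQE.wf_ex_elim.
have [p nz_p [b Db]] := qf_eval_generic qf rf; exists p => //; exists b => x.
move/Db<-; have -> : defined_set phi x = satisfies phi (named_env 1 [:: x]).
  by congr satisfies; apply/funext => i; rewrite ord1.
rewrite -holds_named_formula; apply: (rwP _).
apply: GRing.quantifier_elim_rformP (rformula_named_formula phi).
  exact: ClosedFieldQE.wf_ex_elim.
exact: ClosedFieldQE.holds_ex_elim.
Qed.

End ClosedFieldDefinable.

(** * Countable subfields closed under witnesses *)

Section CountableSubfield.
Variables (K : fieldType) (gen : nat -> K) (wit : K -> seq K).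

(* Trees name the elements obtained from [gen] by subtraction, division and the
   witness functions [fun x => (wit x)`_i]; nodes of the wrong arity name [1]. *)
Fixpoint tree_eval (t : GenTree.tree nat) : K :=
  match t with
  | GenTree.Leaf n => gen n
  | GenTree.Node n s =>
    match n, map tree_eval s with
    | 0, [:: x; y] => x - y
    | 1, [:: x; y] => x / y
    | i.+2, [:: x] => (wit x)`_i
    | _, _ => 1
    end
  end.

Definition generated : {pred K} := fun x => `[< exists t, tree_eval t = x >].

Lemma generated_divring_closed : divring_closed generated.
Proof.
split.
- by apply/asboolP; exists (GenTree.Node 0 [::]).
- move=> _ _ /asboolP[t <-] /asboolP[u <-].
  by apply/asboolP; exists (GenTree.Node 0 [:: t; u]).
- move=> _ _ /asboolP[t <-] /asboolP[u <-].
  by apply/asboolP; exists (GenTree.Node 1 [:: t; u]).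
Qed.

HB.instance Definition _ :=
  GRing.isDivringClosed.Build K generated generated_divring_closed.

Record gen_subfield := GenSubfield {
  gen_subfield_val : K; gen_subfield_valP : gen_subfield_val \in generated}.

HB.instance Definition _ := [isSub for gen_subfield_val].
HB.instance Definition _ := [Choice of gen_subfield by <:].
HB.instance Definition _ := [SubChoice_isSubIntegralDomain of gen_subfield by <:].
HB.instance Definition _ := [SubIntegralDomain_isSubField of gen_subfield by <:].

(** Choosing a name for each element embeds the subfield into the countable type of trees. *)
Let tree_of (x : gen_subfield) : GenTree.tree nat :=
  projT1 (cid (asboolW (gen_subfield_valP x))).
Let of_tree (t : GenTree.tree nat) : gen_subfield := insubd 0 (tree_eval t).

Let tree_ofK : cancel tree_of of_tree.
Proof.
move=> x; rewrite /of_tree /tree_of; case: cid => t /= ->.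
by apply: val_inj; rewrite val_insubd gen_subfield_valP.
Qed.

HB.instance Definition _ := Countable.copy gen_subfield (can_type tree_ofK).

Lemma countable_subfield : exists (F : countFieldType) (j : {rmorphism F -> K}),
  (forall n, exists a, j a = gen n) /\
  (forall a, {in wit (j a), forall z, exists b, j b = z}).
Proof.
exists gen_subfield, val; split=> [n | a z].
  have gen_n : gen n \in generated by apply/asboolP; exists (GenTree.Leaf n).
  by exists (GenSubfield gen_n).
move=> /(nthP 0)[i _ Dz]; have /asboolP[t Dt] := gen_subfield_valP a.
have gen_z : z \in generated.
  by apply/asboolP; exists (GenTree.Node i.+2 [:: t]); rewrite /= Dt.
by exists (GenSubfield gen_z).
Qed.

End CountableSubfield.

(** * Extending embeddings into finite extensions *)

Lemma irreducible_factor (F : fieldType) (p : {poly F}) : (1 < size p)%N ->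
  exists2 q, irreducible_poly q & q %| p.
Proof.
have [n] := ubnP (size p); elim: n p => // n IHn p ltpn p_gt1.
have [irr_p|] := EM (irreducible_poly p); first by exists p.
move=> red_p; have [q [q_neq1 q_dv_p q_neqp]] :
    exists q : {poly F}, [/\ size q != 1%N, q %| p & ~~ (q %= p)].
  apply: contrapT => no_q; apply: red_p; split=> // q q_neq1 q_dv_p.
  by apply/negPn/negP => q_neqp; case: no_q; exists q.
have nz_p : p != 0 by rewrite -size_poly_gt0 ltnW.
have nz_q : q != 0 by apply: contraTneq q_dv_p => ->; rewrite dvd0p.
have q_gt1 : (1 < size q)%N by rewrite ltn_neqAle eq_sym q_neq1 size_poly_gt0.
have ltqp : (size q < size p)%N.
  by rewrite ltn_neqAle dvdp_leq // andbT dvdp_size_eqp.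
have [r irr_r r_dv_q] := IHn q (leq_trans ltqp ltpn) q_gt1.
by exists r => //; apply: dvdp_trans q_dv_p.
Qed.

Lemma finite_extension_root (K : fieldType) (L : fieldExtType K) (p : {poly L}) :
  (1 < size p)%N ->
  exists (L' : fieldExtType K) (tau : {rmorphism L -> L'}),
    (forall x : K, tau x%:A = x%:A) /\ exists z, root (map_poly tau p) z.
Proof.
move=> /irreducible_factor[q irr_q /dvdpP[r ->]].
have [E _ [z qz _]] := irredp_FAdjoin irr_q.
(* [baseFieldType E] is [E] with scalars restricted to [K]; these act through [L], so [in_alg E]
   respects them. *)
exists (baseFieldType E : fieldExtType K), (in_alg E); split; last first.
  by exists z; rewrite rmorphM /= rootM qz orbT.
by [].
Qed.

(** If [p] does not divide some [q] vanishing at [y], the nonzero remainder [q %% p] vanishes there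
    too and has smaller degree, so descent applies. *)
Lemma minimal_poly (F M : fieldType) (iota : {rmorphism F -> M}) (y : M) :
  algebraicOver iota y ->
  exists p : {poly F}, [/\ p != 0, root (map_poly iota p) y &
    forall q, root (map_poly iota q) y -> p %| q].
Proof.
case=> p nz_p py; have [n] := ubnP (size p).
elim: n p nz_p py => // n IHn p nz_p py ltpn.
have [p_min | ] := EM (forall q, root (map_poly iota q) y -> p %| q).
  by exists p.
move=> /existsNP[q /not_implyP[qy /negP p_ndv_q]].
apply: (IHn (q %% p)) => //.
  have := qy; rewrite {1}(divp_eq q p) rmorphD rmorphM /= rootE hornerD hornerM.
  by rewrite (rootP py) mulr0 add0r.
by rewrite (leq_trans _ (ltpn : (size p <= n)%N)) ?ltn_modp.
Qed.

(** Evaluation at [z] is well defined: polynomials that agree at [y] differ by a multiple of [p],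
    which vanishes at [z]. *)
Lemma simple_extension_rmorph (F M L : fieldType) (iota : {rmorphism F -> M})
    (sigma : {rmorphism F -> L}) (y : M) (p : {poly F}) (z : L) :
  p != 0 -> root (map_poly iota p) y ->
  (forall q, root (map_poly iota q) y -> p %| q) ->
  root (map_poly sigma p) z ->
  exists sigma' : {rmorphism subFExtend iota y p -> L},
    forall q, sigma' (subfx_eval iota y p q) = (map_poly sigma q).[z].
Proof.
move=> nz_p py p_min pz.
pose s (x : subFExtend iota y p) : L :=
  (map_poly sigma (projT1 (cid (subfxE x)))).[z].
have sE q : s (subfx_eval iota y p q) = (map_poly sigma q).[z].
  rewrite /s; case: cid => q' /= Dq; apply/eqP; rewrite -subr_eq0 -hornerN.
  rewrite -hornerD -rmorphB /=; have /dvdpP[r ->] : p %| q' - q.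
    apply: p_min; rewrite rootE rmorphB /= hornerD hornerN -!(subfx_inj_eval py nz_p).
    by rewrite Dq subrr.
  by rewrite rmorphM /= hornerM (rootP pz) mulr0.
have sB : zmod_morphism s.
  move=> u v; have [q ->] := subfxE u; have [r ->] := subfxE v.
  by rewrite -rmorphB !sE rmorphB /= hornerD hornerN.
have sM : monoid_morphism s.
  split=> [|u v]; first by rewrite -(rmorph1 (subfx_eval iota y p)) sE rmorph1 hornerC.
  have [q ->] := subfxE u; have [r ->] := subfxE v.
  by rewrite -rmorphM !sE rmorphM /= hornerM.
pose sZ := GRing.isZmodMorphism.Build _ _ s sB.
pose sMon := GRing.isMonoidMorphism.Build _ _ s sM.
pose s' : {rmorphism _ -> _} := HB.pack s sZ sMon.
by exists s'.
Qed.

(** Witnesses are adjoined one at a time: [F] grows by [y], [L] by a root [z] of the image of the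
    minimal polynomial of [y], and [sigma] is extended by sending [y] to [z]. Hence [F], [L] and
    [sigma] vary in the induction. *)
Lemma existential_finite_extension (K M : fieldType) n (phi : rformula n) :
  existential phi ->
  forall (F : fieldType) (L : fieldExtType K) (iota : {rmorphism F -> M})
    (sigma : {rmorphism F -> L}) (e : 'I_n -> F),
  (forall y, algebraicOver iota y) -> satisfies phi (iota \o e) ->
  exists (L' : fieldExtType K) (tau : {rmorphism L -> L'}),
    (forall x : K, tau x%:A = x%:A) /\ satisfies phi (tau \o (sigma \o e)).
Proof.
move=> ex_phi; elim/existential_elim: phi / ex_phi => {}n phi.
  move=> qf F L iota sigma e _ /(qf_satisfies_rmorph iota e qf) sat_e.
  exists L, idfun; split=> //; change (satisfies phi (sigma \o e)).
  exact/(qf_satisfies_rmorph sigma e qf).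
move=> _ IH F L iota sigma e alg_iota [y sat_y].
have [p [nz_p py p_min]] := minimal_poly (alg_iota y).
have p_gt1 : (1 < size (map_poly sigma p))%N.
  rewrite size_map_poly -(size_map_poly iota).
  by apply: root_size_gt1 py; rewrite map_poly_eq0.
have [L1 [tau1 [tau1K [z pz]]]] := finite_extension_root p_gt1.
rewrite -map_poly_comp in pz.
have [sigma' Dsigma'] := simple_extension_rmorph (sigma := tau1 \o sigma) nz_p py p_min pz.
pose F' : fieldType := subFExtend iota y p.
pose iota' : {rmorphism F' -> M} := @subfx_inj F M iota y p.
pose e' := env_cons (subfx_root iota y p) (inj_subfx iota y p \o e).
have iota'E x : iota' (inj_subfx iota y p x) = iota x.
  by rewrite /iota' /inj_subfx /= subfx_inj_eval // map_polyC hornerC.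
have alg_iota' u : algebraicOver iota' u.
  have [q nz_q qu] := alg_iota u.
  exists (map_poly (inj_subfx iota y p) q); first by rewrite map_poly_eq0.
  by rewrite -map_poly_comp (eq_map_poly iota'E).
have sat_e' : satisfies phi (iota' \o e').
  have iota'_root : iota' (subfx_root iota y p) = y by exact: subfx_inj_root.
  rewrite env_cons_comp iota'_root.
  by rewrite (_ : _ \o _ = iota \o e) //; apply/funext => i; exact: iota'E.
have [L' [tau [tauK sat_tau]]] := IH F' L1 iota' sigma' e' alg_iota' sat_e'.
exists L', (tau \o tau1); split=> [x|]; first by rewrite /= tau1K tauK.
exists (tau z); move: sat_tau; rewrite !env_cons_comp.
rewrite {1}/subfx_root Dsigma' map_polyX hornerX.
rewrite (_ : _ \o (_ \o (_ \o e)) = tau \o tau1 \o (sigma \o e)) //.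
by apply/funext => i /=; rewrite Dsigma' map_polyC hornerC.
Qed.

(** * The contradiction on a countable subfield *)

Lemma exists_nonroot (M : fieldType) (p : {poly M}) (u : nat -> M) :
  injective u -> p != 0 -> exists n, p.[u n] != 0.
Proof.
move=> u_inj nz_p; apply: contrapT => /forallNP all_roots.
have : (size (mkseq u (size p)) < size p)%N.
  apply: max_poly_roots => //; last exact: mkseq_uniq.
  by apply/allP => _ /mapP[n _ ->]; apply/negPn/negP/all_roots.
by rewrite size_mkseq ltnn.
Qed.

(** An abstract [Q] serves both for the valuation ring and for its complement; [u] and [v] make [Q]
    neither finite nor cofinite. *)
Lemma existential_trace_not_split (K : fieldType) (psi : rformula 1)
    (Q : K -> Prop) (u v : nat -> K) :
  existential psi ->
  (forall (L : fieldExtType K) (x : K), Q x <-> defined_set psi (x%:A : L)) ->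
  injective u -> injective v ->
  (forall n, Q (u n)) -> (forall n, ~ Q (v n)) -> False.
Proof.
move=> ex_psi Q_psi u_inj v_inj Qu nQv.
have algE (x : K) : x%:A = x :> K^o by exact: mulr1.
have QK (x : K) : Q x <-> defined_set psi x.
  by rewrite (Q_psi (K^o : fieldExtType K)) algE.
(* [Q x] stands under the existential so that [choice] yields a total function. *)
have wit_ex x : exists W : seq K, Q x ->
    forall (F : fieldType) (j : {rmorphism F -> K}) (a : F), j a = x ->
    {in W, forall z, exists b, j b = z} -> defined_set psi a.
  have [/QK sat_x|nQx] := EM (Q x); last by exists [::].
  have [W W_ok] := existential_witnesses ex_psi sat_x.
  exists W => _ F j a ja; apply: W_ok.
  by apply/funext => i; rewrite /= ja.
have [wit witP] := choice wit_ex.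
(* The two sequences are interleaved into one list of generators. *)
pose gen n := if odd n then v n./2 else u n./2.
have [K0 [j [gen_j wit_j]]] := countable_subfield gen wit.
have [M [iota int_iota]] := countable_algebraic_closure K0.
have Q_M a : Q (j a) <-> defined_set psi (iota a).
  split=> [Qa | sat_a].
    have sat_a := witP _ Qa K0 j a erefl (wit_j a).
    exact: existential_satisfies_rmorph ex_psi sat_a.
  pose sigma : {rmorphism K0 -> (K^o : fieldExtType K)} := j.
  have [] := @existential_finite_extension K M _ _ ex_psi K0 _ iota sigma
    (fun=> a) _ sat_a.
    by move=> y; apply/integral_algebraic/int_iota.
  move=> L [tau [tauK sat_L]]; apply/(Q_psi L).
  by rewrite /defined_set -tauK algE.
have lift w : (forall n, exists a, j a = w n) -> injective w ->
    exists2 w0 : nat -> K0, forall n, j (w0 n) = w n & injective (iota \o w0).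
  move=> /choice[w0 jw0] w_inj; exists w0 => // m n /fmorph_inj eq_w0.
  by apply: w_inj; rewrite -!jw0 eq_w0.
have [u0 ju0 u0_inj] : exists2 u0 : nat -> K0,
    forall n, j (u0 n) = u n & injective (iota \o u0).
  apply: lift => // n; have [a ja] := gen_j n.*2; exists a.
  by rewrite ja /gen odd_double doubleK.
have [v0 jv0 v0_inj] : exists2 v0 : nat -> K0,
    forall n, j (v0 n) = v n & injective (iota \o v0).
  apply: lift => // n; have [a ja] := gen_j n.*2.+1; exists a.
  by rewrite ja /gen /= odd_double /= uphalf_double.
(* Some [u m] and some [v n] avoid the roots of [p], so [psi] has the same truth value [b] at both,
   against [Qu] and [nQv]. *)
have [p nz_p [b psi_b]] := defined_set_generic M psi.
have [m /psi_b psi_u] := exists_nonroot u0_inj nz_p.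
have [n /psi_b psi_v] := exists_nonroot v0_inj nz_p.
apply: (nQv n); rewrite -jv0; apply/Q_M/psi_v/psi_u/Q_M.
by rewrite ju0.
Qed.

(** * Powers of an element of positive value *)

Section ValuationPowers.
Variables (K : fieldType) (v : valuation K).

Lemma vval1 : vval v 1 = 0.
Proof.
apply: (addrI (vval v 1)); rewrite addr0 -vvalM ?oner_neq0 //.
by rewrite mulr1.
Qed.

Lemma vvalV (x : K) : x != 0 -> vval v x^-1 = - vval v x.
Proof.
move=> nz_x; apply/eqP; rewrite -addr_eq0 -vvalM ?invr_eq0 // mulVf //.
exact/eqP/vval1.
Qed.

Lemma vgroup_addr_gt0 (a b : vgroup v) : 0 < a -> 0 < b -> 0 < a + b.
Proof.
move=> a_gt0 b_gt0; apply: lt_le_trans a_gt0 _.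
by rewrite -[leLHS]addr0; apply/vgroup_leD/ltW.
Qed.

Lemma vgroup_oppr_lt0 (a : vgroup v) : 0 < a -> - a < 0.
Proof.
move=> a_gt0; rewrite lt_neqAle oppr_eq0 gt_eqF //=.
by have := vgroup_leD (- a) (ltW a_gt0); rewrite addr0 addNr.
Qed.

Lemma vvalX_gt0 (t : K) n : t != 0 -> 0 < vval v t -> 0 < vval v (t ^+ n.+1).
Proof.
move=> nz_t t_gt0; elim: n => [|n IHn]; first by rewrite expr1.
by rewrite exprS vvalM ?expf_neq0 //; apply: vgroup_addr_gt0.
Qed.

Lemma exists_vval_gt0 : nontrivial_valuation v ->
  exists2 t : K, t != 0 & 0 < vval v t.
Proof.
case=> x nz_x nz_vx; have [vx_ge0|vx_le0] := orP (vgroup_total 0 (vval v x)).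
  by exists x; rewrite // lt_def nz_vx.
exists x^-1; first by rewrite invr_eq0.
rewrite lt_def vvalV // oppr_eq0 nz_vx /=.
by have := vgroup_leD (- vval v x) vx_le0; rewrite addr0 addNr.
Qed.

(** Two equal powers would make some positive power of [t] equal to 1, whose value is 0. *)
Lemma vval_gt0_powers_inj (t : K) : t != 0 -> 0 < vval v t ->
  injective (fun n => t ^+ n.+1).
Proof.
move=> nz_t t_gt0.
have lt_neq m n : (m < n)%N -> t ^+ m.+1 != t ^+ n.+1.
  move=> lt_mn; apply/eqP => eq_mn; have := vvalX_gt0 (n - m.+1) nz_t t_gt0.
  rewrite -subSn // (_ : t ^+ (n.+1 - m.+1) = 1) ?vval1 ?ltxx //.
  by rewrite expfB ?ltnS // eq_mn divff // expf_neq0.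
move=> m n /= eq_mn; case: (ltngtP m n) => // /lt_neq; last rewrite eq_sym.
  by rewrite eq_mn eqxx.
by rewrite eq_mn eqxx.
Qed.

End ValuationPowers.

(** * Restriction of valuation rings, and conclusion *)

Lemma valring_extends (K : fieldType) (L : fieldExtType K)
    (v : valuation K) (w : valuation L) (x : K) :
  valuation_extends v w -> (x%:A \in valring w) = (x \in valring v).
Proof.
case=> f [f_mono f_val]; rewrite !unfold_in /valring scaler_eq0 oner_eq0 orbF.
(* Writing 0 as [f 0] makes the sign condition a comparison that [f] reflects. *)
by have [//|nz_x] := eqVneq x 0; rewrite f_val // -(raddf0 f) f_mono.
Qed.

Theorem theorem1p4 (K : fieldType) (v : valuation K)
    (v_nontrivial : nontrivial_valuation v) (v_henselian : henselian v)
    (w : forall L : fieldExtType K, valuation L)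
    (w_extends : forall L : fieldExtType K, valuation_extends v (w L)) :
  (~ exists psi : rformula 1, existential psi /\
       forall (L : fieldExtType K) (x : L),
         x \in valring (w L) <-> defined_set psi x) /\
  (~ exists eta : rformula 1, universal eta /\
       forall (L : fieldExtType K) (x : L),
         x \in valring (w L) <-> defined_set eta x).
Proof.
have [t nz_t t_gt0] := exists_vval_gt0 v_nontrivial.
have u_inj := vval_gt0_powers_inj nz_t t_gt0.
have v_inj : injective (fun n => (t ^+ n.+1)^-1).
  by move=> m n /invr_inj/u_inj.
have u_in n : t ^+ n.+1 \in valring v.
  by rewrite unfold_in; apply/orP; right; apply/ltW/vvalX_gt0.
have v_out n : ~ ((t ^+ n.+1)^-1 \in valring v).
  have nz_tn : t ^+ n.+1 != 0 by rewrite expf_neq0.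
  apply/negP; rewrite unfold_in /valring invr_eq0 negb_or nz_tn /= vvalV //.
  by rewrite lt_geF // vgroup_oppr_lt0 // vvalX_gt0.
split=> [[psi [ex_psi O_psi]]|[eta [un_eta O_eta]]].
  apply: (existential_trace_not_split (Q := fun x => x \in valring v)
    ex_psi _ u_inj v_inj u_in v_out) => L x.
  by rewrite -O_psi (valring_extends x (w_extends L)).
have [ex_eta sat_eta] := universal_dualP un_eta.
(* For the complement the two sequences change places. *)
apply: (existential_trace_not_split (Q := fun x => ~ (x \in valring v))
  ex_eta _ v_inj u_inj v_out) => [L x|n /(_ (u_in n))//].
rewrite /defined_set sat_eta -(valring_extends x (w_extends L)).
by split=> nx; move: (O_eta L x%:A) => Ox /Ox.
Qed.
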